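(* Let $D$ be a weighted oriented path of length $n$ with underlying graph $G=P_n=x_0x_1\cdots x_n$, such that every vertex of $V^+$ is a sink, and such that $D$ is not in the class $T_1$. Then $$\operatorname{reg}(I(D))=\operatorname{reg}(I(G))+\sum_{x_i\in V^+}(w(x_i)-1).$$
   Context: A weighted oriented graph $D=(V(D),E(D),w)$ has directed edges $(x,y)$ and weights $w:V(D)\to\{1,2,\dots\}$; a source is assumed to have weight $1$. Its edge ideal is $I(D)=(x_ix_j^{w(x_j)}:(x_i,x_j)\in E(D))$ in the polynomial ring over a field whose variables are the vertices; $I(G)$ is the usual squarefree edge ideal of the simple underlying graph $G$. $V^+=\{x\in V(D): w(x)\ge 2\}$. A sink is a vertex all of whose incident edges are oriented into it. A path of length $n$ has $n$ edges. $T_1$ is the set of weighted oriented paths in which the vertices of $V^+$ are sinks, both end vertices lie in $V^+$, and the distance between any two consecutive vertices of $V^+$ along the path is $3$. $\operatorname{reg}$ is Castelnuovo–Mumford regularity. *)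

(* Defs.v *)
From HB Require Import structures.
From mathcomp Require Import all_boot all_order all_algebra.
From mathcomp Require Import mpoly.
From Stdlib Require Import ClassicalEpsilon.

Set Implicit Arguments.
Unset Strict Implicit.
Unset Printing Implicit Defensive.

Import GRing.Theory.
Local Open Scope ring_scope.

(** * Castelnuovo-Mumford regularity of an ideal of K[x_0, ..., x_(N-1)] *)

(* Ideals are represented by their membership predicates. *)
Definition ideal_gen (R : comNzRingType) (T : finType) (A : pred T)
    (g : T -> R) : R -> Prop :=
  fun f => exists c : T -> R, f = \sum_(t | A t) c t * g t.

(* F_i is the free module of row vectors of length [rank i], whose a-th basis
   vector has degree [shift i a]; maps act on row vectors on the right:
   ... -> F_2 -(diff 1)-> F_1 -(diff 0)-> F_0 -(aug)-> R.
   Nothing bounds the length; the resolution is finite iff the ranks are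
   eventually 0. *)
Record free_complex (K : fieldType) (N : nat) := FreeComplex {
  rank : nat -> nat;
  shift : forall i, 'I_(rank i) -> nat;
  aug : 'cV[{mpoly K[N]}]_(rank 0);
  diff : forall i, 'M[{mpoly K[N]}]_(rank i.+1, rank i)
}.

Definition graded (K : fieldType) (N : nat) (F : free_complex K N) : Prop :=
  (forall a m, m \in msupp (aug F a 0) -> mdeg m = shift a)
  /\ (forall i a b m, m \in msupp (diff F i a b) ->
        (mdeg m + shift b = shift a)%N).

Definition resolves (K : fieldType) (N : nat) (F : free_complex K N)
    (I : {mpoly K[N]} -> Prop) : Prop :=
  [/\ forall f, I f <-> exists u : 'rV_(rank F 0), (u *m aug F) 0 0 = f,
      forall u : 'rV_(rank F 0),
        u *m aug F = 0 <-> exists v, u = v *m diff F 0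
    & forall i (u : 'rV_(rank F i.+1)),
        u *m diff F i = 0 <-> exists v, u = v *m diff F i.+1].

(* The entries of the differentials lie in the ideal (x_0, ..., x_(N-1)). *)
Definition minimal (K : fieldType) (N : nat) (F : free_complex K N) : Prop :=
  forall i a b, (diff F i a b)@_0%MM = 0.

Definition minimal_graded_free_resolution (K : fieldType) (N : nat)
    (F : free_complex K N) (I : {mpoly K[N]} -> Prop) : Prop :=
  [/\ graded F, resolves F I & minimal F].

(* r = max {j - i : beta_(i,j)(I) <> 0}, where beta_(i,j)(I) is the number of
   basis vectors of degree j of the i-th module of a minimal graded free
   resolution of I. The differences j - i are never negative for an ideal. *)
Definition has_reg (K : fieldType) (N : nat) (I : {mpoly K[N]} -> Prop)
    (r : nat) : Prop :=
  exists F : free_complex K N,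
    [/\ minimal_graded_free_resolution F I,
        forall i (a : 'I_(rank F i)), (shift a <= r + i)%N
      & exists i (a : 'I_(rank F i)), shift a = (r + i)%N].

(* Every nonzero homogeneous ideal has exactly one regularity; the value of
   [reg] at any other predicate (such as the zero ideal) is unspecified. *)
Definition reg (K : fieldType) (N : nat) (I : {mpoly K[N]} -> Prop) : nat :=
  epsilon (inhabits 0%N) (has_reg I).

(** * Weighted oriented graphs and edge ideals *)

Record wograph (N : nat) := WOGraph {
  arc : rel 'I_N;
  wt : 'I_N -> nat;
  arc_irr : forall x, ~~ arc x x;
  arc_asym : forall x y, arc x y -> ~~ arc y x;
  wt_gt0 : forall x, (0 < wt x)%N;
  wt_source : forall x, (forall y, ~~ arc y x) -> wt x = 1%N
}.

Definition underlying (N : nat) (D : wograph N) : rel 'I_N :=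
  fun x y => arc D x y || arc D y x.

Definition Vplus (N : nat) (D : wograph N) : {set 'I_N} :=
  [set x | (2 <= wt D x)%N].

Definition is_sink (N : nat) (D : wograph N) (x : 'I_N) : Prop :=
  forall y, ~~ arc D x y.

Definition edge_ideal (K : fieldType) (N : nat) (G : rel 'I_N) :
    {mpoly K[N]} -> Prop :=
  ideal_gen (fun e : 'I_N * 'I_N => G e.1 e.2) (fun e => 'X_e.1 * 'X_e.2).

Definition wo_edge_ideal (K : fieldType) (N : nat) (D : wograph N) :
    {mpoly K[N]} -> Prop :=
  ideal_gen (fun e : 'I_N * 'I_N => arc D e.1 e.2)
            (fun e => 'X_e.1 * 'X_e.2 ^+ wt D e.2).

Arguments edge_ideal K {N} G _.
Arguments wo_edge_ideal K {N} D _.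

Definition path_graph (n : nat) : rel 'I_n.+1 :=
  fun x y => (y == x.+1 :> nat) || (x == y.+1 :> nat).

Definition is_wopath (n : nat) (D : wograph n.+1) : Prop :=
  underlying D =2 @path_graph n.

Definition T1 (n : nat) (D : wograph n.+1) : Prop :=
  [/\ is_wopath D,
      forall x, x \in Vplus D -> is_sink D x,
      ord0 \in Vplus D,
      ord_max \in Vplus D
    & forall x y : 'I_n.+1, x \in Vplus D -> y \in Vplus D -> (x < y)%N ->
        (forall z : 'I_n.+1, (x < z < y)%N -> z \notin Vplus D) ->
        (y - x = 3)%N].

(* Main.v *)
Require Import Defs.
From mathcomp Require Import all_boot all_order all_algebra.
From mathcomp Require Import mpoly zify.
From Stdlib Require Import ClassicalEpsilon FunctionalExtensionality.
From Stdlib Require Import PropExtensionality.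

Set Implicit Arguments.
Unset Strict Implicit.
Unset Printing Implicit Defensive.

Import GRing.Theory.

(** The vertices of [V^+] being sinks, [I(D)] is obtained from [I(G)] by
    substituting [x_i^w(x_i)] for [x_i].  Let [J_v] be the ideal generated by
    the products [y_i y_(i+1)] with [i + 1 < v], where [y_i = x_i^w(x_i)].  Then
    [J_(v+3) = J_(v+2) + (y_(v+1) y_(v+2))] and
    [J_(v+2) : y_(v+1) y_(v+2) = J_v + (y_v)], so that iterated mapping cones,
    all of them minimal, resolve [J_v] and give the recursion
    [reg R/J_(v+3) = max (reg R/J_(v+2),
                          reg R/J_v + w_v + w_(v+1) + w_(v+2) - 2)].
    Hence [reg R/J_v <= floor ((v + 1) / 3) + sum (w_i - 1)], with equality for
    [v = n + 1] unless [n = 3k] and all of [x_0, x_3, ..., x_(3k)] are in [V^+].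
    Then all other vertices are adjacent to sinks, so [D] is in [T_1]. *)

(** * Graded matrices, comparison of resolutions, uniqueness of the regularity *)

Section GradedMatrices.
Local Open Scope ring_scope.
Variables (K : fieldType) (N : nat).
Local Notation R := {mpoly K[N]}.

Definition mxgraded p q (s : 'I_p -> nat) (t : 'I_q -> nat)
    (A : 'M[R]_(p, q)) : Prop :=
  forall a b m, m \in msupp (A a b) -> (mdeg m + t b = s a)%N.

Lemma mxgradedM p q r (s : 'I_p -> nat) (t : 'I_q -> nat) (u : 'I_r -> nat)
    (A : 'M[R]_(p, q)) (B : 'M[R]_(q, r)) :
  mxgraded s t A -> mxgraded t u B -> mxgraded s u (A *m B).
Proof.
move=> gA gB a c m; rewrite mxE => /msupp_sum_le /flatten_mapP [b _].
move=> /msuppM_le /allpairsP [[m1 m2] /= [/gA <- /gB <- ->]].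
by rewrite mdegD addnA.
Qed.

Lemma mxgraded_shift p q e (s : 'I_p -> nat) (t : 'I_q -> nat)
    (A : 'M[R]_(p, q)) :
  mxgraded s t A -> mxgraded (fun a => s a + e)%N (fun b => t b + e)%N A.
Proof. by move=> gA a b m /gA <-; rewrite addnA. Qed.

Lemma mxgradedZX p q (k : 'X_{1..N}) (s : 'I_p -> nat) (t : 'I_q -> nat)
    (A : 'M[R]_(p, q)) :
  mxgraded s t A -> mxgraded (fun a => s a + mdeg k)%N t ('X_[k] *: A).
Proof.
move=> gA a b m; rewrite mxE mulrC (perm_mem (msuppMX _ _)).
by case/mapP=> m' /gA <- ->; rewrite mdegD; lia.
Qed.

Definition mfilter (P : pred 'X_{1..N}) (p : R) : R :=
  \sum_(m <- msupp p | P m) p@_m *: 'X_[m].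

Lemma mcoeff_filter P p m : (mfilter P p)@_m = if P m then p@_m else 0.
Proof.
rewrite /mfilter raddf_sum /=.
under eq_bigr do rewrite mcoeffZ mcoeffX.
case: ifP => Pm; last first.
  rewrite big1 // => m' Pm'; case: eqP => [E|]; last by rewrite mulr0.
  by rewrite E Pm in Pm'.
rewrite [in RHS](mpolyE p) raddf_sum /= big_mkcond /=.
apply: eq_bigr => m' _; rewrite mcoeffZ mcoeffX.
by case: eqP => [->|_]; rewrite ?Pm // mulr0 if_same.
Qed.

Lemma msupp_filter P p m : (m \in msupp (mfilter P p)) = P m && (m \in msupp p).
Proof. by rewrite !mcoeff_msupp mcoeff_filter; case: (P m); rewrite ?eqxx. Qed.

(* Replace the entries of [W] by their homogeneous components of the degrees
   required by [s] and [t]. *)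
Lemma mxgraded_factor p q r (s : 'I_p -> nat) (t : 'I_q -> nat)
    (u : 'I_r -> nat) (A : 'M[R]_(p, r)) (B : 'M[R]_(q, r)) W :
  mxgraded s u A -> mxgraded t u B -> A = W *m B ->
  exists2 W', mxgraded s t W' & A = W' *m B.
Proof.
move=> gA gB defA.
exists (\matrix_(a, b) mfilter (fun m => mdeg m + t b == s a)%N (W a b)).
  by move=> a b m; rewrite mxE msupp_filter => /andP [/eqP].
apply/matrixP => a c; rewrite mxE; apply/mpolyP => k.
(* As [B] is graded, a monomial of the product fixes the degree of the factor taken from [W a b], so
   filtering keeps its coefficient entirely or kills it. *)
have eqs b : ((mfilter (fun m => mdeg m + t b == s a)%N (W a b)) * B b c)@_k
    = (W a b * B b c)@_k *+ (mdeg k + u c == s a)%N.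
  rewrite !mcoeffM -sumrMnl; apply: eq_bigr => k12 /eqP/(congr1 mdeg).
  case: k12 => [[k1 ?] [k2 ?]] /=; rewrite mdegD mcoeff_filter => ->.
  have [/gB <-|/memN_msupp_eq0 ->] := boolP (k2 \in msupp (B b c)).
    by rewrite addnA mulrb; case: ifP; rewrite ?mul0r.
  by rewrite !mulr0 mul0rn.
rewrite raddf_sum /=; under eq_bigr => b _ do rewrite mxE eqs.
rewrite sumrMnl mulrb; case: ifP => dk; first by rewrite defA mxE raddf_sum.
apply/eqP; rewrite mcoeff_eq0; apply: contraFN dk.
by move=> /gA ->.
Qed.

(** Exactness is stated for row vectors; choosing a preimage of each row gives factorizations of
    whole matrices. *)
Lemma row_factor p q r (A : 'M[R]_(p, r)) (B : 'M[R]_(q, r)) :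
  (forall a, exists v, row a A = v *m B) -> exists W, A = W *m B.
Proof.
move=> /fin_all_exists [v vE]; exists (\matrix_a v a).
by apply/row_matrixP => a; rewrite row_mul rowK.
Qed.

Section Resolution.
Variables (F : free_complex K N) (I : R -> Prop).
Hypothesis resF : resolves F I.

Lemma aug_mem a : I (aug F a 0).
Proof.
case: resF => ex _ _; apply/ex; exists (delta_mx 0 a).
by rewrite -rowE mxE.
Qed.

Lemma diff0_aug : diff F 0 *m aug F = 0.
Proof.
case: resF => _ ex _; apply/row_matrixP => a; rewrite row_mul row0.
by apply/ex; exists (delta_mx 0 a); rewrite rowE.
Qed.

Lemma diff_diff i : diff F i.+1 *m diff F i = 0.
Proof.
case: resF => _ _ ex; apply/row_matrixP => a; rewrite row_mul row0.
by apply/ex; exists (delta_mx 0 a); rewrite rowE.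
Qed.

Lemma aug_factor p (A : 'cV[R]_p) :
  (forall a, I (A a 0)) -> exists W, A = W *m aug F.
Proof.
case: resF => ex _ _ IA; apply: row_factor => a.
have /ex [u uE] := IA a; exists u; apply/matrixP => i j.
by rewrite !ord1 uE mxE.
Qed.

Lemma diff0_factor p (A : 'M[R]_(p, rank F 0)) :
  A *m aug F = 0 -> exists W, A = W *m diff F 0.
Proof.
case: resF => _ ex _ A0; apply: row_factor => a; apply/ex.
by rewrite -row_mul A0 row0.
Qed.

Lemma diff_factor p i (A : 'M[R]_(p, rank F i.+1)) :
  A *m diff F i = 0 -> exists W, A = W *m diff F i.+1.
Proof.
case: resF => _ _ ex A0; apply: row_factor => a; apply/ex.
by rewrite -row_mul A0 row0.
Qed.

End Resolution.

(** The usual lifting through the exactness of [F], made homogeneous at each stage by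
    [mxgraded_factor]; the twist by [mdeg k] makes multiplication by ['X_[k]] preserve degrees. *)
Lemma comparison (F G : free_complex K N) (I J : R -> Prop) (k : 'X_{1..N}) :
  graded F -> graded G -> resolves F I -> resolves G J ->
  (forall f, J f -> I (f * 'X_[k])) ->
  exists phi : forall i, 'M[R]_(rank G i, rank F i),
  [/\ phi 0 *m aug F = 'X_[k] *: aug G,
      forall i, phi i.+1 *m diff F i = diff G i *m phi i
    & forall i,
        mxgraded (fun a => shift a + mdeg k)%N (@shift _ _ F i) (phi i)].
Proof.
move=> gF gG resF resG JI.
have gF0 : mxgraded (@shift _ _ F 0) (fun=> 0%N) (aug F).
  by move=> a b m; rewrite (ord1 b) addn0; apply: gF.1.
have gG0 : mxgraded (@shift _ _ G 0) (fun=> 0%N) (aug G).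
  by move=> a b m; rewrite (ord1 b) addn0; apply: gG.1.
have gd i : mxgraded (fun a => shift a + mdeg k)%N
    (fun a => shift a + mdeg k)%N (diff G i).
  by apply: mxgraded_shift; apply: gG.2.
(* The second conjunct says that the next square can be completed, which lets the recursion
   continue. *)
pose inv i (f : 'M[R]_(rank G i, rank F i)) :=
  mxgraded (fun a => shift a + mdeg k)%N (@shift _ _ F i) f /\
  exists W, diff G i *m f = W *m diff F i.
have [phi0 [inv0 E0]] :
    exists f, inv 0%N f /\ f *m aug F = 'X_[k] *: aug G.
  have [W EW] : exists W, 'X_[k] *: aug G = W *m aug F.
    apply: (aug_factor resF) => a; rewrite mxE mulrC; apply: JI.
    exact: (aug_mem resG).
  have [f gf Ef] := mxgraded_factor (mxgradedZX (k := k) gG0) gF0 EW.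
  exists f; split=> //; split=> //; apply: (diff0_factor resF).
  by rewrite -mulmxA -Ef -scalemxAr (diff0_aug resG) scaler0.
have step i (f : {f | inv i f}) : {g : {g | inv i.+1 g} |
    sval g *m diff F i = diff G i *m sval f}.
  apply: constructive_indefinite_description.
  case: f => f [gf [W EW]] /=.
  have [g gg Eg] := mxgraded_factor (mxgradedM (gd i) gf) (gF.2 i) EW.
  suff invg : inv i.+1 g by exists (exist _ g invg).
  split=> //; apply: (diff_factor resF).
  by rewrite -mulmxA -Eg mulmxA (diff_diff resG) mul0mx.
pose phi := nat_rect (fun i => {f | inv i f}) (exist _ phi0 inv0)
  (fun i f => sval (step i f)).
exists (fun i => sval (phi i)); split=> // [i|i].
  exact: (svalP (step i (phi i))).
by case: (svalP (phi i)).
Qed.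


(* Lifting makes [chi] null-homotopic, and the entries of the boundary maps have
   no constant term. *)
Lemma chain_map_const0 (F : free_complex K N) (I : R -> Prop)
    (chi : forall i, 'M[R]_(rank F i)) :
  resolves F I -> minimal F -> chi 0 *m aug F = 0 ->
  (forall i, chi i.+1 *m diff F i = diff F i *m chi i) ->
  forall i, map_mx (mcoeff 0) (chi i) = 0.
Proof.
move=> resF minF chi0 chiS i.
have const_diff j : map_mx (mcoeff 0) (diff F j) = 0.
  by apply/matrixP => a b; rewrite !mxE minF.
(* The induction carries a homotopy [h]; its equation makes [chi i.+1 - diff F i *m h] a cycle at
   the next stage. *)
suff [h _ //] : exists2 h : 'M[R]_(rank F i, rank F i.+1),
    diff F i *m (chi i - h *m diff F i) = 0 & map_mx (mcoeff 0) (chi i) = 0.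
elim: i => [|i [h dh _]].
  have [h ->] := diff0_factor resF chi0; exists h.
    by rewrite subrr mulmx0.
  by rewrite map_mxM const_diff mulmx0.
have [h' Eh'] : exists h', chi i.+1 - diff F i *m h = h' *m diff F i.+1.
  apply: (diff_factor resF).
  by rewrite mulmxBl chiS -mulmxA -mulmxBr.
have Echi : chi i.+1 = h' *m diff F i.+1 + diff F i *m h.
  by rewrite -Eh' subrK.
exists h'.
  by rewrite Echi addrAC subrr add0r mulmxA (diff_diff resF) mul0mx.
by rewrite Echi map_mxD !map_mxM !const_diff mulmx0 mul0mx addr0.
Qed.

(** The comparison maps compose to the identity modulo the variables, so row [a] of [phi i] has an
    entry with nonzero constant term, and homogeneity equates the two degrees. *)
Lemma shift_invariant (F G : free_complex K N) (I : R -> Prop) :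
  minimal_graded_free_resolution F I ->
  minimal_graded_free_resolution G I ->
  forall i (a : 'I_(rank F i)), exists b : 'I_(rank G i), shift b = shift a.
Proof.
move=> [gF resF minF] [gG resG minG] i a.
have stable f : I f -> I (f * 'X_[0]) by rewrite mpolyX0 mulr1.
have [phi [phi0 phiS gphi]] := comparison gG gF resG resF stable.
have [psi [psi0 psiS gpsi]] := comparison gF gG resF resG stable.
have /(_ i) : forall i, map_mx (mcoeff 0) (phi i *m psi i - 1%:M) = 0.
  apply: (chain_map_const0 resF minF) => [|j].
    rewrite mulmxBl mul1mx -mulmxA psi0 -scalemxAr phi0 mpolyX0 !scale1r.
    exact: subrr.
  by rewrite mulmxBl mulmxBr mulmx1 mul1mx -mulmxA psiS mulmxA phiS mulmxA.
move=> /matrixP/(_ a a); rewrite !mxE eqxx raddfB raddf_sum /= mcoeff1 eqxx.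
have [/existsP [b nz] _|/existsPn zero] :=
    boolP [exists b, (phi i a b)@_0 != 0].
  exists b; move: nz; rewrite -mcoeff_msupp => /gphi.
  by rewrite !mdeg0 addn0.
rewrite big1 => [|b _]; last by rewrite rmorphM /= (eqP (negPn (zero b))) mul0r.
by rewrite sub0r => /eqP; rewrite oppr_eq0 oner_eq0.
Qed.

Lemma has_reg_uniq (I : R -> Prop) r s : has_reg I r -> has_reg I s -> r = s.
Proof.
have le t t' : has_reg I t -> has_reg I t' -> (t <= t')%N.
  move=> [F [resF _ [i [a Ea]]]] [G [resG leG _]].
  have [b Eb] := shift_invariant resF resG a.
  by rewrite -(leq_add2r i) -Ea -Eb.
by move=> hr hs; apply/eqP; rewrite eqn_leq !le.
Qed.

Lemma regE (I : R -> Prop) r : has_reg I r -> reg I = r.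
Proof.
move=> hr; apply: (has_reg_uniq _ hr).
by apply: (epsilon_spec (inhabits 0%N)); exists r.
Qed.

End GradedMatrices.

(** * Mapping cones for adding one generator to an ideal *)

Section MappingCone.
Local Open Scope ring_scope.
Variables (K : fieldType) (N : nat) (F G : free_complex K N).
Local Notation R := {mpoly K[N]}.
Variables (f : R) (d : nat).
Variable phi : forall i, 'M[R]_(rank G i, rank F i).

(** For [J = I : f] with [f] of degree [d], the cone of [phi] resolves [I + (f)]. The extra rank 1
    in homological degree 0 carries the generator [f]; since [G] resolves [J] and not the quotient
    by [J], [G j] sits in homological degree [j + 1], twisted by [d]. *)
Definition cone_rank i :=
  if i is j.+1 then (rank F j.+1 + rank G j)%N else (rank F 0 + 1)%N.

Definition cone_shift i : 'I_(cone_rank i) -> nat :=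
  match i with
  | 0 => fun a => if split a is inl b then shift b else d
  | j.+1 => fun a =>
      match split a with inl b => shift b | inr b => (shift b + d)%N end
  end.

Definition cone_aug : 'cV[R]_(cone_rank 0) := col_mx (aug F) f%:M.

Definition cone_diff i : 'M[R]_(cone_rank i.+1, cone_rank i) :=
  match i with
  | 0 => block_mx (diff F 0) 0 (phi 0) (- aug G)
  | j.+1 => block_mx (diff F j.+1) 0 (phi j.+1) (- diff G j)
  end.

Definition cone : free_complex K N :=
  FreeComplex cone_shift cone_aug cone_diff.

Variables (I J : R -> Prop).
Hypotheses (resF : resolves F I) (resG : resolves G J).
Hypothesis phi0 : phi 0 *m aug F = f *: aug G.
Hypothesis phiS : forall i, phi i.+1 *m diff F i = diff G i *m phi i.
Hypothesis colon : forall p, J p <-> I (p * f).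

(** The [G] part of a cycle is lifted first, then the [F] part corrected by [phi]. At the bottom, a
    relation between [f] and elements of [I] puts the coefficient of [f] in the colon ideal [J]. *)
Lemma cone_resolves :
  resolves cone (fun p => exists a b, I a /\ p = a + b * f).
Proof.
have [exF0 exF1 exF2] := resF; have [exG0 exG1 exG2] := resG.
split.
- move=> p; split.
    move=> [a [b [/exF0 [u uE] ->]]]; exists (row_mx u b%:M).
    by rewrite mul_row_col mxE uE -scalar_mxM mxE mulr1n.
  move=> [u <-]; exists ((lsubmx u *m aug F) 0 0), (rsubmx u 0 0); split.
    by apply/exF0; exists (lsubmx u).
  rewrite -{1}[u]hsubmxK mul_row_col mxE; congr (_ + _).
  by rewrite mul_mx_scalar mxE mulrC.
- move=> u; rewrite -[u]hsubmxK; set u1 := lsubmx _; set c := rsubmx _.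
  split=> [|[v]]; last first.
    rewrite -[v]hsubmxK mul_row_block mulmx0 add0r => /eq_row_mx [-> ->].
    rewrite mul_row_col mulmxDl -!mulmxA (diff0_aug resF) mulmx0 add0r phi0.
    by rewrite mul_mx_scalar scalerN mulmxN subrr.
  rewrite mul_row_col mul_mx_scalar => E.
  have /exG0 [v2 v2E] : J (c 0 0).
    apply/colon/exF0; exists (- u1); rewrite mulNmx.
    rewrite (eqP (_ : - (u1 *m aug F) == f *: c)) ?mxE 1?mulrC //.
    by rewrite eq_sym -addr_eq0 addrC E.
  have cE : c = v2 *m aug G by apply/matrixP => i j; rewrite !ord1 v2E.
  have [v1 v1E] : exists v1, u1 + v2 *m phi 0 = v1 *m diff F 0.
    by apply/exF1; rewrite mulmxDl -mulmxA phi0 -scalemxAr -cE.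
  exists (row_mx v1 (- v2)); rewrite mul_row_block mulmx0 add0r.
  by rewrite -v1E mulNmx addrK mulNmx mulmxN opprK -cE.
(* Index 0 stands apart because the differential there has the block [- aug G] in place of a
   [- diff G]. *)
- move=> [|i] u; rewrite -[u]hsubmxK; set u1 := lsubmx _; set u2 := rsubmx _.
  + split=> [|[v]]; last first.
      rewrite -[v]hsubmxK !mul_row_block !mulmx0 !add0r => /eq_row_mx [-> ->].
      rewrite -row_mx0 mulmxDl -!mulmxA (diff_diff resF) mulmx0 add0r phiS.
      by rewrite !(mulmxN, mulNmx) opprK (diff0_aug resG) mulmx0 subrr.
    rewrite mul_row_block mulmx0 add0r -row_mx0 => /eq_row_mx [E1 E2].
    have [v2 v2E] : exists v2, u2 = v2 *m diff G 0.
      by apply/exG1; apply/eqP; rewrite -oppr_eq0 -mulmxN E2.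
    have [v1 v1E] : exists v1, u1 + v2 *m phi 1%N = v1 *m diff F 1.
      by apply/exF2; rewrite mulmxDl -mulmxA phiS mulmxA -v2E.
    exists (row_mx v1 (- v2)); rewrite mul_row_block mulmx0 add0r.
    by rewrite -v1E mulNmx addrK mulNmx mulmxN opprK -v2E.
  + split=> [|[v]]; last first.
      rewrite -[v]hsubmxK !mul_row_block !mulmx0 !add0r => /eq_row_mx [-> ->].
      rewrite -row_mx0 mulmxDl -!mulmxA (diff_diff resF) mulmx0 add0r phiS.
      by rewrite !(mulmxN, mulNmx) opprK (diff_diff resG) mulmx0 subrr.
    rewrite mul_row_block mulmx0 add0r -row_mx0 => /eq_row_mx [E1 E2].
    have [v2 v2E] : exists v2, u2 = v2 *m diff G i.+1.
      by apply/exG2; apply/eqP; rewrite -oppr_eq0 -mulmxN E2.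
    have [v1 v1E] : exists v1, u1 + v2 *m phi i.+2 = v1 *m diff F i.+2.
      by apply/exF2; rewrite mulmxDl -mulmxA phiS mulmxA -v2E.
    exists (row_mx v1 (- v2)); rewrite mul_row_block mulmx0 add0r.
    by rewrite -v1E mulNmx addrK mulNmx mulmxN opprK -v2E.
Qed.

Hypotheses (gF : graded F) (gG : graded G).
Hypothesis f_homog : forall m, m \in msupp f -> mdeg m = d.
Hypothesis gphi : forall i,
  mxgraded (fun a => shift a + d)%N (@shift _ _ F i) (phi i).

Lemma cone_graded : graded cone.
Proof.
split=> [a m|i a b m] /=.
  rewrite /cone_aug mxE; case: (split a) => [c /gF.1 -> //|c].
  by rewrite !ord1 mxE mulr1n => /f_homog.
case: i a b => [|i] a b /=; rewrite -[a]splitK -[b]splitK.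
  case: (split a) (split b) => [a1|a2] [b1|b2]; rewrite !unsplitK /=.
  - by rewrite block_mxEul => /gF.2.
  - by rewrite block_mxEur mxE msupp0.
  - by rewrite block_mxEdl => /gphi.
  - by rewrite block_mxEdr mxE (perm_mem (msuppN _)) !ord1 => /gG.1 ->.
case: (split a) (split b) => [a1|a2] [b1|b2]; rewrite !unsplitK /=.
- by rewrite block_mxEul => /gF.2.
- by rewrite block_mxEur mxE msupp0.
- by rewrite block_mxEdl => /gphi.
- by rewrite block_mxEdr mxE (perm_mem (msuppN _)) addnA => /gG.2 ->.
Qed.

Hypotheses (minF : minimal F) (minG : minimal G).
Hypothesis J_proper : forall p, J p -> p@_0 = 0.
Hypothesis phi_const : forall i a b, (phi i a b)@_0 = 0.

Lemma cone_minimal : minimal cone.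
Proof.
case=> [|i] a b /=; rewrite -[a]splitK -[b]splitK.
  case: (split a) (split b) => [a1|a2] [b1|b2] /=.
  - by rewrite block_mxEul minF.
  - by rewrite block_mxEur mxE mcoeff0.
  - by rewrite block_mxEdl phi_const.
  (* The augmentation of [G] is now part of a differential, so its entries, which lie in [J], must
     have no constant term. *)
  - rewrite block_mxEdr mxE mcoeffN !ord1.
    by rewrite (J_proper (aug_mem resG a2)) oppr0.
case: (split a) (split b) => [a1|a2] [b1|b2] /=.
- by rewrite block_mxEul minF.
- by rewrite block_mxEur mxE mcoeff0.
- by rewrite block_mxEdl phi_const.
- by rewrite block_mxEdr mxE mcoeffN minG oppr0.
Qed.

End MappingCone.

(** * Monomial ideals and the regularity of their quotients *)

Section MonomialIdeals.
Local Open Scope ring_scope.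
Variables (K : fieldType) (N : nat).
Local Notation R := {mpoly K[N]}.
Implicit Types (P Q : 'X_{1..N} -> Prop) (f : R).

(** A monomial ideal is determined by its set [P] of exponents, so colons and sums become statements
    about exponents. *)
Definition monomial_ideal P f : Prop := forall m, m \in msupp f -> P m.

Lemma monomial_idealMX P k f :
  monomial_ideal P (f * 'X_[k]) <-> monomial_ideal (fun m => P (m + k)%MM) f.
Proof.
split=> [h m mf|h m].
  by apply: h; rewrite (perm_mem (msuppMX _ _)) addmC map_f.
by rewrite (perm_mem (msuppMX _ _)) => /mapP [m' /h + ->]; rewrite addmC.
Qed.

Lemma monomial_ideal_add P k f :
  monomial_ideal (fun m => P m \/ (k <= m)%MM) f <->
  exists a b, monomial_ideal P a /\ f = a + b * 'X_[k].
Proof.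
split=> [h|[a [b [Pa ->]]] m]; last first.
  move=> /msuppD_le; rewrite mem_cat => /orP [/Pa|]; first by left.
  rewrite (perm_mem (msuppMX _ _)) => /mapP [m' _ ->]; right.
  exact: lem_addr.
(* The terms of [f] not divisible by ['X_[k]] form [a]; the others, divided by it, form [b]. *)
exists (mfilter (fun m => ~~ (k <= m)%MM) f).
exists (\sum_(m <- msupp f | (k <= m)%MM) f@_m *: 'X_[m - k]); split.
  by move=> m; rewrite msupp_filter => /andP [/negP nk /h []].
have -> : (\sum_(m <- msupp f | (k <= m)%MM) f@_m *: 'X_[m - k]) * 'X_[k]
    = mfilter (fun m => (k <= m)%MM) f.
  rewrite big_distrl; apply: eq_bigr => m le_km /=.
  by rewrite -scalerAl -mpolyXD submK.
apply/mpolyP => m; rewrite mcoeffD !mcoeff_filter.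
by case: (k <= m)%MM; rewrite /= ?addr0 ?add0r.
Qed.

Lemma monomial_ideal_gen (T : finType) (A : pred T) (e : T -> 'X_{1..N}) f :
  ideal_gen A (fun t => 'X_[e t]) f <->
  monomial_ideal (fun m => exists2 t, A t & (e t <= m)%MM) f.
Proof.
split=> [[c ->] m /msupp_sum_le /flatten_mapP [t]|h].
  rewrite mem_filter => /andP [At _].
  rewrite (perm_mem (msuppMX _ _)) => /mapP [m' _ ->].
  by exists t => //; apply: lem_addr.
rewrite (mpolyE f) big_seq.
apply: (big_rec (ideal_gen A _)) => [|m x /h [t At le_tm] [c ->]].
  by exists (fun=> 0); rewrite big1 // => t _; rewrite mul0r.
exists (fun s => (if s == t then f@_m *: 'X_[m - e t] else 0) + c s).
under [RHS]eq_bigr do rewrite mulrDl.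
rewrite big_split; congr (_ + _).
rewrite (bigD1 t) //= eqxx big1 => [|s /andP [_ /negPf ->]].
  by rewrite addr0 -scalerAl -mpolyXD submK.
by rewrite mul0r.
Qed.

(* The regularity of the quotient by [I]: it adds to a resolution of [I] the
   free module of rank 1 in homological degree 0, so that [r = 0] is also
   attained when [I] is the zero ideal. *)
Definition quotient_reg (I : R -> Prop) r : Prop :=
  exists F : free_complex K N,
    [/\ minimal_graded_free_resolution F I,
        forall i (a : 'I_(rank F i)), (shift a <= r + i.+1)%N
      & r = 0%N \/ exists i (a : 'I_(rank F i)), shift a = (r + i.+1)%N].

Lemma quotient_reg_ext (I J : R -> Prop) r :
  (forall f, I f <-> J f) -> quotient_reg I r -> quotient_reg J r.
Proof.
move=> IJ [F [[gF [F0 F1 F2] mF] leF exF]]; exists F; split=> //; split=> //.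
by split=> // f; rewrite -IJ.
Qed.

(** Passing from the quotient to the ideal lowers homological degrees by one; [0 < r] excludes that
    the value is attained only by the added free module of rank 1. *)
Lemma has_reg_quotient (I : R -> Prop) r :
  (0 < r)%N -> quotient_reg I r -> has_reg I r.+1.
Proof.
move=> r_gt0 [F [resF leF exF]]; exists F; split=> //.
  by move=> i a; rewrite addSnnS.
case: exF => [r0|[i [a Ea]]]; first by rewrite r0 in r_gt0.
by exists i, a; rewrite Ea addSnnS.
Qed.

Lemma quotient_reg0 : quotient_reg (monomial_ideal (fun=> False)) 0.
Proof.
have noord (a : 'I_0) : False by case: a.
exists (@FreeComplex K N (fun=> 0%N) (fun _ _ => 0%N) 0 (fun _ => 0)).
split; [split| by move=> i [] | by left].
- by split=> [[]|i []].
- split=> [f|u|i u].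
  + split=> [h|[u <-]].
      exists 0; rewrite mul0mx mxE; apply/esym/eqP; rewrite -msupp_eq0.
      by case E: (msupp f) => [//|m s]; case: (h m); rewrite E mem_head.
    by move=> m; rewrite mulmx0 mxE msupp0.
  + split=> _; last by rewrite mulmx0.
    by exists 0; rewrite mul0mx; apply/matrixP => i [].
  + split=> _; last by rewrite mulmx0.
    by exists 0; rewrite mul0mx; apply/matrixP => ? [].
- by move=> i [].
Qed.

(* The cone is again minimal since its comparison map is divisible by ['X_[p]],
   which has positive degree. *)
Lemma quotient_reg_cone P Q (p q : 'X_{1..N}) r s :
  (0 < mdeg p)%N ->
  (forall m, Q m <-> P (m + (p + q))%MM) ->
  (forall m, Q m -> P (m + q)%MM) -> ~ Q 0%MM ->
  quotient_reg (monomial_ideal P) r -> quotient_reg (monomial_ideal Q) s ->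
  quotient_reg (monomial_ideal (fun m => P m \/ (p + q <= m)%MM))
    (maxn r (s + (mdeg (p + q)).-1)).
Proof.
move=> p_gt0 colon Qq Q0 [F [resF leF exF]] [G [resG leG exG]].
have [gF rF mF] := resF; have [gG rG mG] := resG.
(* Lifting only the multiplication by ['X_[q]] leaves the factor ['X_[p]] to be applied to the whole
   chain map. *)
have stable f : monomial_ideal Q f -> monomial_ideal P (f * 'X_[q]).
  by move=> h; apply/monomial_idealMX => m /h /Qq.
have [phi [phi0 phiS gphi]] := comparison gF gG rF rG stable.
pose psi i := 'X_[p] *: phi i.
pose d := mdeg (p + q).
have d_gt0 : (0 < d)%N by rewrite /d mdegD addn_gt0 p_gt0.
have psi0 : psi 0 *m aug F = 'X_[p + q] *: aug G.
  by rewrite -scalemxAl phi0 scalerA -mpolyXD.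
have psiS i : psi i.+1 *m diff F i = diff G i *m psi i.
  by rewrite -scalemxAl phiS scalemxAr.
have gpsi i : mxgraded (fun a => shift a + d)%N (@shift _ _ F i) (psi i).
  by move=> a b m /(mxgradedZX (gphi i)) ->; rewrite /d mdegD; lia.
have cpsi i a b : (psi i a b)@_0 = 0.
  rewrite mxE rmorphM /= mcoeffX -mdeg_eq0.
  by case: (mdeg p) p_gt0 => // ? _; rewrite mul0r.
have colonf f : monomial_ideal Q f <-> monomial_ideal P (f * 'X_[p + q]).
  rewrite monomial_idealMX.
  by split=> h m /h /colon.
have properQ f : monomial_ideal Q f -> f@_0 = 0.
  by move=> h; apply: memN_msupp_eq0; apply/negP => /h.
have Xd m : m \in msupp ('X_[p + q] : R) -> mdeg m = d.
  by rewrite msuppX inE => /eqP ->.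
apply: (quotient_reg_ext (fun f => iff_sym (monomial_ideal_add P (p + q) f))).
exists (cone 'X_[p + q] d psi); split; first split.
- exact: cone_graded.
- exact: cone_resolves rF rG psi0 psiS colonf.
- exact: cone_minimal rG mF mG properQ cpsi.
- case=> [|i] a /=; case: (split a) => b.
  + by have := leF _ b; lia.
  + lia.
  + by have := leF _ b; lia.
  + by have := leG _ b; lia.
- rewrite /maxn; case: ifP => _.
    (* The second value is attained by the new generator, of degree [d], if [s = 0], and otherwise
       by an extremal basis vector of [G], moved up by one homological step and by [d] in degree. *)
    right; case: exG => [->|[i [b Eb]]].
      exists 0%N, (rshift _ ord0) => /=.
      by rewrite -[rshift _ _]/(unsplit (inr _)) unsplitK; lia.
    exists i.+1, (rshift _ b) => /=.
    by rewrite -[rshift _ _]/(unsplit (inr _)) unsplitK Eb -/d; lia.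
  case: exF => [->|[i [b Eb]]]; first by left.
  right; case: i b Eb => [|i] b Eb.
    exists 0%N, (lshift _ b) => /=.
    by rewrite -[lshift _ _]/(unsplit (inl _)) unsplitK.
  exists i.+1, (lshift _ b) => /=.
  by rewrite -[lshift _ _]/(unsplit (inl _)) unsplitK.
Qed.

End MonomialIdeals.

(** * Closed form of the numerical recursion *)

Fixpoint path_reg (W : nat -> nat) v : nat :=
  match v with
  | 0 | 1 => 0
  | 2 => (W 0 + W 1).-1
  | (u.+2 as v').+1 =>
      maxn (path_reg W v')
        (path_reg W u + (W u).-1 + (W u.+1 + W u.+2).-1)
  end.

Section PathReg.
Variable W : nat -> nat.
Hypothesis W_gt0 : forall i, 0 < W i.

Lemma path_regS3 v :
  path_reg W v.+3 = maxn (path_reg W v.+2)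
    (path_reg W v + (W v).-1 + (W v.+1 + W v.+2).-1).
Proof. by []. Qed.

(** Three more vertices raise the quotient by 1, and [(W v).-1 + (W v.+1 + W v.+2).-1] exceeds the
    three new summands by exactly 1. *)
Lemma path_reg_le v : path_reg W v <= v.+1 %/ 3 + \sum_(i < v) (W i - 1).
Proof.
elim/ltn_ind: v => -[|[|[|v]]] IH //.
  by rewrite !big_ord_recr big_ord0 /=; have := W_gt0 0; have := W_gt0 1; lia.
have := IH v.+2 (leqnn _); have := IH v (leqW (leqW (leqnn _))).
rewrite path_regS3 !big_ord_recr /= geq_max.
by have := W_gt0 v; have := W_gt0 v.+1; have := W_gt0 v.+2; lia.
Qed.

(** For residues 0 and 2 the second term of the maximum propagates equality from the base cases.
    Residue 1 starts from a single vertex, where equality needs weight 1, or restarts at a last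
    vertex of weight 1. *)
Lemma path_regE v :
  (v %% 3 = 1 -> exists2 j, 3 * j < v & W (3 * j) = 1) ->
  path_reg W v = v.+1 %/ 3 + \sum_(i < v) (W i - 1).
Proof.
move=> W1; apply/eqP; rewrite eqn_leq path_reg_le /=.
elim/ltn_ind: v W1 => -[|[|[|v]]] IH W1.
- by rewrite big_ord0.
- have [j] := W1 erefl; rewrite big_ord_recr big_ord0 /= => ltj.
  have -> : 3 * j = 0 by lia.
  by move=> ->.
- by rewrite !big_ord_recr big_ord0 /=; have := W_gt0 0; have := W_gt0 1; lia.
have [/eqP v1|nv1] := boolP (v %% 3 == 1); last first.
  have := IH v (leqW (leqW (leqnn _))) (fun e => False_ind _ (elimN eqP nv1 e)).
  rewrite path_regS3 !big_ord_recr /= leq_max.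
  by have := W_gt0 v; have := W_gt0 v.+1; have := W_gt0 v.+2; lia.
have [j ltj Wj] : exists2 j, 3 * j < v.+3 & W (3 * j) = 1 by apply: W1; lia.
have [lt_jv|ge_jv] := ltnP (3 * j) v.
  have := IH v (leqW (leqW (leqnn _))) (fun=> ex_intro2 _ _ j lt_jv Wj).
  rewrite path_regS3 !big_ord_recr /= leq_max.
  by have := W_gt0 v; have := W_gt0 v.+1; have := W_gt0 v.+2; lia.
(* The last vertex has weight 1 and leaves the formula unchanged, so the first term of the maximum
   suffices: [v.+2] is divisible by 3, a residue already settled. *)
have Ej : 3 * j = v.+2 by lia.
have := IH v.+2 (leqnn _); rewrite path_regS3 [in X in _ -> X]big_ord_recr /=.
rewrite -Ej Wj Ej leq_max subnn.
have nv2 : v.+2 %% 3 <> 1 by lia.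
by move=> /(_ (fun e => False_ind _ (nv2 e))); lia.
Qed.

End PathReg.

(** * Regularity of the path ideals by iterated cones *)

Section PathIdeal.
Variables (K : fieldType) (n : nat) (W : nat -> nat).
Hypothesis W_gt0 : forall i, 0 < W i.
Implicit Types m k : 'X_{1..n.+1}.

Definition vertex_pow i : 'X_{1..n.+1} := (U_(inord i) *+ W i)%MM.

(** The exponents of [J_v]; vertices are reached from [nat] through [inord], which keeps the
    induction on [v] free of ordinals. *)
Definition contains_edge v m : Prop :=
  exists i, [/\ i.+1 < v, W i <= m (inord i) & W i.+1 <= m (inord i.+1)].

Lemma inord_eq i j : i <= n -> j <= n ->
  (inord i == inord j :> 'I_n.+1) = (i == j).
Proof. by move=> lei lej; rewrite -val_eqE /= !inordK. Qed.

Lemma vertex_powE i j : i <= n -> j <= n ->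
  vertex_pow i (inord j) = if i == j then W i else 0.
Proof.
by move=> lei lej; rewrite mulmnE mnm1E inord_eq //; case: eqP; lia.
Qed.

Lemma mdeg_vertex_pow i : mdeg (vertex_pow i) = W i.
Proof. by rewrite mdegMn mdeg1 mul1n. Qed.

Lemma le_vertex_pow i m : i <= n ->
  (vertex_pow i <= m)%MM = (W i <= m (inord i)).
Proof.
move=> lei; apply/mnm_lepP/idP => [/(_ (inord i))|h j].
  by rewrite vertex_powE ?eqxx.
rewrite -(inord_val j) vertex_powE //; last by rewrite -ltnS.
by case: eqP => [<-|].
Qed.

Lemma le_vertex_powD i j m : i <= n -> j <= n -> i != j ->
  (vertex_pow i + vertex_pow j <= m)%MM
    = (W i <= m (inord i)) && (W j <= m (inord j)).
Proof.
move=> lei lej neq_ij; rewrite -!le_vertex_pow //.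
apply/idP/andP => [h|[/mnm_lepP hi /mnm_lepP hj]].
  by split; apply: lepm_trans h; [apply: lem_addr|apply: lem_addl].
apply/mnm_lepP => x; move: (hi x) (hj x); rewrite mnmDE -(inord_val x).
have lex : x <= n by rewrite -ltnS.
rewrite !vertex_powE //.
case: eqP => [ix|_]; case: eqP => [jx|_]; [|lia..].
by move: neq_ij; rewrite ix jx eqxx.
Qed.

(** The generators of [J_v] only involve variables of index less than [v]. *)
Lemma contains_edgeD v m k : (forall i, i < v -> k (inord i) = 0) ->
  contains_edge v (m + k)%MM <-> contains_edge v m.
Proof.
move=> k0; split=> [] [i [lti mi mi1]]; exists i; move: mi mi1;
  by rewrite !mnmDE !k0 ?addn0 //; lia.
Qed.

Lemma path_quotient_reg v : v <= n.+1 ->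
  quotient_reg (monomial_ideal (K := K) (contains_edge v)) (path_reg W v).
Proof.
have noedge u : u <= 1 -> forall m, contains_edge u m <-> False.
  by move=> leu m; split=> // [[i [? _ _]]]; lia.
have ideal_ext P Q : (forall m, P m <-> Q m) -> forall r,
    quotient_reg (monomial_ideal (K := K) P) r ->
    quotient_reg (monomial_ideal (K := K) (N := n.+1) Q) r.
  move=> PQ r; apply: quotient_reg_ext => f.
  by split=> h m /h /PQ.
have edgeS u : u < n -> forall m, contains_edge u.+2 m <->
    contains_edge u.+1 m \/ (vertex_pow u.+1 + vertex_pow u <= m)%MM.
  move=> ltu m; rewrite le_vertex_powD; [|lia..]; split.
    move=> [i [lti mi mi1]]; have [Ei|ne] := eqVneq i u.
      by right; rewrite -Ei mi mi1.
    by left; exists i; split=> //; lia.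
  case=> [[i [lti mi mi1]]|/andP [mu1 mu]]; [exists i|exists u] => //.
  by split=> //; lia.
elim/ltn_ind: v => -[|[|[|v]]] IH lev.
- by apply: ideal_ext (quotient_reg0 K n.+1) => m; rewrite noedge.
- by apply: ideal_ext (quotient_reg0 K n.+1) => m; rewrite noedge.
- apply: (ideal_ext _ _ (fun m => iff_sym (edgeS 0 lev m))).
  have IH1 := IH 1 isT (ltnW lev).
  have := quotient_reg_cone (p := vertex_pow 1) (q := vertex_pow 0)
    _ _ _ _ IH1 IH1.
  rewrite mdegD !mdeg_vertex_pow max0n [W 1 + _]addnC; apply=> //.
  + by move=> m; rewrite !noedge.
  + by move=> m; rewrite noedge.
  + by rewrite noedge.
have edge0 u : ~ contains_edge u 0%MM.
  by move=> [i [_ + _]]; rewrite mnmE leqNgt W_gt0.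
have colon : quotient_reg (monomial_ideal (K := K)
    (fun m => contains_edge v m \/ (vertex_pow v + 0 <= m)%MM))
    (path_reg W v + (W v).-1).
  (* The variable of [y_v] is absent from [J_v], so [J_v : y_v] is [J_v] again, and [q = 0] will
     do. *)
  have IHv := IH v (leqW (leqW (leqnn _))) (ltnW (ltnW (ltnW lev))).
  have := quotient_reg_cone (p := vertex_pow v) (q := 0%MM) _ _ _ _ IHv IHv.
  rewrite addm0 mdeg_vertex_pow (maxn_idPr (leq_addr _ _)); apply=> // m.
    rewrite contains_edgeD // => i lti; rewrite vertex_powE; [|lia..].
    by case: eqP; lia.
  by rewrite addm0.
apply: (ideal_ext _ _ (fun m => iff_sym (edgeS v.+1 lev m))).
(* The choice [q = y_(v+1)] is admissible because [y_v y_(v+1)] already lies in [J_(v+2)]. *)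
have := quotient_reg_cone (p := vertex_pow v.+2) (q := vertex_pow v.+1) _ _ _ _
  (IH v.+2 (leqnn _) (ltnW lev)) colon.
rewrite mdegD !mdeg_vertex_pow path_regS3 [W v.+2 + _]addnC addm0; apply=> //.
- move=> m; rewrite le_vertex_pow; last by lia.
  split=> [[[i [lti mi mi1]]|mv]|[i [lti]]].
  + by exists i; rewrite !mnmDE; split; lia.
  + exists v; rewrite !mnmDE !vertex_powE ?eqxx; [|lia..].
    by split; lia.
  rewrite !mnmDE !vertex_powE; [|lia..].
  have -> : (v.+2 == i) = false by lia.
  have -> : (v.+2 == i.+1) = false by lia.
  have -> : (v.+1 == i) = false by lia.
  (* An edge at vertex [v] makes [y_v] divide the monomial; every other edge is one of [J_v]. *)
  rewrite eqSS !addn0; have [-> mv _|nei mi] := eqVneq i v; first by right.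
  rewrite /= !addn0; have [-> mv|nei1 mi1] := eqVneq i.+1 v; first by right.
  by left; exists i; split=> //; lia.
- move=> m [[i [lti mi mi1]]|]; first by exists i; rewrite !mnmDE; split; lia.
  rewrite le_vertex_pow; last by lia.
  move=> mv; exists v; rewrite !mnmDE !vertex_powE ?eqxx; [|lia..].
  by split; lia.
- case=> [/edge0 //|/mnm_lepP/(_ (inord v))].
  by rewrite vertex_powE ?eqxx ?mnmE; have := W_gt0 v; lia.
Qed.

End PathIdeal.

(** * Edge ideals of weighted oriented paths *)

(** Serves both ideals: [A] is the arc relation for [I(D)] and the symmetric adjacency for
    [I(G)]. *)
Lemma ideal_gen_path (K : fieldType) n (A : rel 'I_n.+1) (W : nat -> nat)
    (g : 'I_n.+1 * 'I_n.+1 -> {mpoly K[n.+1]}) f :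
  (fun x y => A x y || A y x) =2 @path_graph n ->
  (forall x y, A x y ->
     g (x, y) = ('X_[vertex_pow n W x + vertex_pow n W y])%R) ->
  ideal_gen (fun e => A e.1 e.2) g f <->
  monomial_ideal (contains_edge W n.+1) f.
Proof.
move=> pathA gE; pose e (t : 'I_n.+1 * 'I_n.+1) :=
  (vertex_pow n W t.1 + vertex_pow n W t.2)%MM.
have -> : ideal_gen (fun e => A e.1 e.2) g f <->
    ideal_gen (fun e => A e.1 e.2) (fun t => 'X_[e t])%R f.
  by split=> [] [c ->]; exists c; apply: eq_bigr => [[x y]] /gE /= ->.
rewrite monomial_ideal_gen.
have edgeE m : (exists2 t, A t.1 t.2 & (e t <= m)%MM) <->
    contains_edge W n.+1 m.
  split=> [[[x y] /= Axy]|[i [lti mi mi1]]].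
    have lex : x <= n by rewrite -ltnS.
    have ley : y <= n by rewrite -ltnS.
    have : path_graph x y by rewrite -pathA Axy.
    rewrite /path_graph => pxy.
    rewrite /e /= le_vertex_powD //; last by lia.
    case/andP => mx my; case/orP: pxy => /eqP exy.
      by exists x; rewrite -exy; split=> //; rewrite -exy.
    by exists y; rewrite -exy; split.
  have [Ei Ei1] : (inord i : 'I_n.+1) = i :> nat /\
      (inord i.+1 : 'I_n.+1) = i.+1 :> nat.
    by split; rewrite inordK; lia.
  have : path_graph (inord i : 'I_n.+1) (inord i.+1).
    by rewrite /path_graph Ei Ei1 eqxx.
  rewrite -pathA => /orP [] Axy.
    exists (inord i, inord i.+1) => //.
    by rewrite /e /= Ei Ei1 le_vertex_powD ?mi //; lia.
  exists (inord i.+1, inord i) => //.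
  by rewrite /e /= Ei Ei1 le_vertex_powD ?mi1 ?mi //; lia.
by split=> h m /h /edgeE.
Qed.

Lemma has_reg_path (K : fieldType) n (W : nat -> nat)
    (I : {mpoly K[n.+1]} -> Prop) :
  0 < n -> (forall i, 0 < W i) ->
  (forall f, I f <-> monomial_ideal (contains_edge W n.+1) f) ->
  (n.+1 %% 3 = 1 -> exists2 j, 3 * j <= n & W (3 * j) = 1) ->
  has_reg I (n.+2 %/ 3 + \sum_(i < n.+1) (W i - 1)).+1.
Proof.
move=> n_gt0 W_gt0 IE W1; rewrite -(path_regE W_gt0 W1).
(* Positivity comes from [0 < n], which makes [n.+2 %/ 3] at least 1. *)
apply: has_reg_quotient; first by rewrite (path_regE W_gt0 W1); lia.
apply: quotient_reg_ext (path_quotient_reg K W_gt0 (leqnn n.+1)) => f.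
exact: iff_sym (IE f).
Qed.

(** If all multiples of 3 had weight at least 2, they would be sinks; each other vertex is adjacent
    to one of them, and adjacent vertices are not both sinks, so [V^+] would be exactly the set of
    multiples of 3. *)
Lemma not_T1_weight1 n (D : wograph n.+1) :
  is_wopath D -> (forall x, x \in Vplus D -> is_sink D x) -> ~ T1 D ->
  n.+1 %% 3 = 1 -> exists2 j, 3 * j <= n & wt D (inord (3 * j)) = 1.
Proof.
move=> path sink nT1 n3.
have [/existsP [x /andP [/dvdnP [j xj] /eqP wx]]|/existsPn heavy] :=
    boolP [exists x : 'I_n.+1, (3 %| x) && (wt D x == 1)].
  exists j; first by have := ltn_ord x; lia.
  by rewrite mulnC -xj inord_val.
case: nT1.
have Vmul (x : 'I_n.+1) : 3 %| x -> x \in Vplus D.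
  move=> x3; have := heavy x; rewrite x3 inE /= => wx.
  by have := wt_gt0 D x; lia.
have Vadj (x y : 'I_n.+1) : path_graph x y -> x \in Vplus D -> y \notin Vplus D.
  move=> pxy /sink/(_ y) nxy; apply/negP => /sink/(_ x) nyx.
  by move: pxy; rewrite -path /underlying (negbTE nxy) (negbTE nyx).
have mulV (x : 'I_n.+1) : x \in Vplus D -> 3 %| x.
  move=> Vx; have ltx := ltn_ord x.
  have [//|n0] := boolP (3 %| x).
  (* For residue 2 the neighbour [x + 1] exists because 3 divides [n]. *)
  have [x1|x2] : x %% 3 = 1 \/ x %% 3 = 2 by lia.
    have := Vadj (inord x.-1) x; rewrite Vx /path_graph inordK; last by lia.
    have -> : x == x.-1.+1 :> nat by lia.
    by move=> /(_ isT); rewrite Vmul ?inordK; [move/(_ isT)|lia..].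
  have := Vadj (inord x.+1) x; rewrite Vx /path_graph inordK; last by lia.
  rewrite eqxx orbT => /(_ isT).
  by rewrite Vmul ?inordK; [move/(_ isT)|lia..].
split=> //; [exact: Vmul| by apply: Vmul; rewrite /=; lia|].
move=> x y Vx Vy ltxy between.
have x3 := mulV x Vx; have y3 := mulV y Vy.
have [|far] := eqVneq (x + 3) y; first by lia.
have lty := ltn_ord y.
have := between (inord (x + 3)); rewrite inordK; last by lia.
by rewrite Vmul ?inordK; [move=> h; have := h ltac:(lia)|lia..].
Qed.

Theorem theorem4p2 (K : fieldType) (n : nat) (D : wograph n.+1)
    (hpath : is_wopath D)
    (hsink : forall x : 'I_n.+1, x \in Vplus D -> is_sink D x)
    (hT1 : ~ T1 D) :
  reg (wo_edge_ideal K D) =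
    (reg (edge_ideal K (underlying D))
     + \sum_(x : 'I_n.+1 | x \in Vplus D) (wt D x - 1))%N.
Proof.
pose W i := wt D (inord i).
have W_gt0 i : 0 < W i by apply: wt_gt0.
have woE f : wo_edge_ideal K D f <->
    monomial_ideal (contains_edge W n.+1) f.
  apply: ideal_gen_path => // x y Axy /=.
  (* The tail of an arc is not a sink, so it has weight 1 and the generator is the product of the
     two vertex powers. *)
  have wx : wt D x = 1.
    apply/eqP; rewrite eqn_leq wt_gt0 andbT leqNgt; apply/negP => Vx.
    by have := hsink x; rewrite inE => /(_ Vx y); rewrite Axy.
  by rewrite mpolyXD /vertex_pow -!mpolyXn /W !inord_val wx expr1.
have edE f : edge_ideal K (underlying D) f <->
    monomial_ideal (contains_edge (fun=> 1) n.+1) f.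
  apply: ideal_gen_path => [x y|x y _ /=].
    rewrite -hpath /underlying.
    by case: (Defs.arc D x y); case: (Defs.arc D y x).
  by rewrite mpolyXD /vertex_pow !inord_val !mulm1n.
(* With one vertex both ideals are zero, where [reg] is unspecified; the regularities agree because
   the ideals are the same predicate, and the sum is empty because the vertex is a source. *)
have [n0|n_gt0] := posnP n.
  have V0 x : x \in Vplus D -> False.
    rewrite inE wt_source // => y; apply/negP => Ayx.
    have := ltn_ord x; have := ltn_ord y; have : path_graph x y.
      by rewrite -hpath /underlying Ayx orbT.
    by rewrite /path_graph; lia.
  rewrite big1 => [|x /V0 //]; rewrite addn0; congr reg.
  apply: functional_extensionality => f; apply: propositional_extensionality.
  rewrite woE edE.
  by split=> h m /h [i [lti _ _]]; lia.
rewrite (regE (has_reg_path n_gt0 W_gt0 woE (not_T1_weight1 hpath hsink hT1))).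
have one_gt0 (i : nat) : 0 < 1 by [].
(* For [I(G)] all weights are 1, so vertex 0 meets the condition on multiples of 3. *)
rewrite (regE (has_reg_path n_gt0 one_gt0 edE _)); last first.
  by exists 0.
rewrite [\sum_(i < n.+1) (1 - 1)]big1 // addn0 -addSn.
rewrite [in RHS]big_mkcond; congr (_ + _); apply: eq_bigr => x _.
by rewrite /W inord_val inE; case: ltnP => // ?; lia.
Qed.
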